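(* Let $(X,\mathcal{M},\mu)$ be a $\sigma$-finite measure space and $\Phi$ an $N^*$-function for which there is a constant $k\ge2$ with $\Phi(kx)=2\Phi(x)$ for all $x>0$. A functional $U$ on $L_\Phi(X)$ is continuous and linear if and only if either (a) $\Lambda=\emptyset$ and $U\equiv0$, or (b) $\Lambda\ne\emptyset$ and $U(f)=\sum_iu_i\overline f_i$ with $\|U\|=\sup_i|u_i|\,\Phi^{-1}(1/a_i)<\infty$, where $\{A_i\}$ is a finite or countable family of pairwise disjoint atoms such that every atom coincides up to a $\mu$-null set with exactly one $A_i$, $a_i=\mu(A_i)$, and $\overline f_i$ is the a.e. constant value of $f$ on $A_i$.
   Context: An $N^*$-function is a function $\Phi:\mathbb{R}\to\mathbb{R}$ of the form $\Phi(x)=\int_0^{|x|}p(t)\,dt<+\infty$ for all $x$, where $p:[0,\infty)\to[0,\infty]$ is right-continuous, positive on $(0,\infty)$, non-increasing, and satisfies $\lim_{t\to0^+}p(t)=+\infty$ and $\lim_{t\to+\infty}p(t)=0$. $\Phi^{-1}$ is the inverse of $\Phi|_{[0,\infty)}$. $L_\Phi(X)$ is the space of (classes modulo a.e. equality of) measurable $f$ with $\int_X\Phi(f)\,d\mu<\infty$, with quasi-norm $\|f\|_\Phi=\inf\{\lambda>0:\int_X\Phi(|f|/\lambda)\,d\mu\le1\}$; for a linear functional $U$, $\|U\|=\sup\{|U(f)|:\|f\|_\Phi\le1\}$. An atom is a set $A\in\mathcal{M}$ with $\mu(A)>0$ such that every measurable $B\subset A$ with $\mu(B)<\mu(A)$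 has $\mu(B)=0$; $\Lambda$ denotes the collection of atoms. *)

(* Defs.v *)
From HB Require Import structures.
From mathcomp Require Import all_boot all_order all_algebra.
From mathcomp Require Import all_classical all_reals all_analysis.
Set Implicit Arguments. Unset Strict Implicit. Unset Printing Implicit Defensive.
Import Order.TTheory GRing.Theory Num.Theory.
Import numFieldNormedType.Exports.
Local Open Scope classical_set_scope.
Local Open Scope ring_scope.

Section Defs.
Context (R : realType).

Definition NStar_function (Phi : R -> R) : Prop :=
  exists p : R -> \bar R,
    [/\ [/\ (forall t, 0 <= t -> (0 <= p t)%E),
        (forall t, 0 <= t -> p x @[x --> t^'+] --> p t),
        (forall t, 0 < t -> (0 < p t)%E) &
        (forall s t, 0 <= s -> s <= t -> (p t <= p s)%E)],
        p t @[t --> 0^'+] --> +oo%E,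
        p t @[t --> +oo] --> 0%E &
        (forall x : R, (\int[@lebesgue_measure R]_(t in `[0%R, `|x|%R]) p t)%E = (Phi x)%:E)].

Definition Phi_inv (Phi : R -> R) (y : R) : R :=
  xget 0 [set x : R | 0 <= x /\ Phi x = y].

Context (d : measure_display) (T : measurableType d)
        (mu : {measure set T -> \bar R}) (Phi : R -> R).

Definition LPhi (f : T -> R) : Prop :=
  measurable_fun setT f /\ (\int[mu]_x (Phi (f x))%:E < +oo)%E.

Definition Phi_norm (f : T -> R) : R :=
  inf [set l : R | 0 < l /\ (\int[mu]_x (Phi (`|f x| / l))%:E <= 1)%E].

Definition op_norm (U : (T -> R) -> R) : \bar R :=
  ereal_sup [set (`|U f|)%:E | f in [set f | LPhi f /\ Phi_norm f <= 1]].

Definition linear_on_LPhi (U : (T -> R) -> R) : Prop :=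
  forall (a : R) f g, LPhi f -> LPhi g -> U (fun x => a * f x + g x) = a * U f + U g.

Definition continuous_on_LPhi (U : (T -> R) -> R) : Prop :=
  forall f, LPhi f -> forall e : R, 0 < e -> exists2 del : R, 0 < del &
    forall g, LPhi g -> Phi_norm (fun x => g x - f x) < del -> `|U g - U f| < e.

Definition is_atom (A : set T) : Prop :=
  [/\ measurable A, (0 < mu A)%E &
      forall B, measurable B -> B `<=` A -> (mu B < mu A)%E -> mu B = 0%E].

Definition Lambda : set (set T) := [set A | is_atom A].

Definition symdiff (A B : set T) : set T := (A `\` B) `|` (B `\` A).

Definition atom_family (I : set nat) (A : nat -> set T) : Prop :=
  [/\ forall i, I i -> is_atom (A i),
      forall i j, I i -> I j -> i <> j -> A i `&` A j = set0 &
      forall B, is_atom B -> exists! i, I i /\ mu (symdiff B (A i)) = 0%E].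

Definition ae_const_val (A : set T) (f : T -> R) : R :=
  xget 0 [set c : R | mu (A `&` [set x | f x != c]) = 0%E].

End Defs.

(* Main.v *)
Require Import Defs.
From HB Require Import structures.
From mathcomp Require Import all_boot all_order all_algebra.
From mathcomp Require Import all_classical all_reals all_analysis.
From mathcomp Require Import measurable_realfun lra.
Set Implicit Arguments. Unset Strict Implicit. Unset Printing Implicit Defensive.
Import Order.TTheory GRing.Theory Num.Theory.
Import numFieldNormedType.Exports.
Local Open Scope classical_set_scope.
Local Open Scope ring_scope.

(** The relation Phi(k x) = 2 Phi(x) forces k > 2, since p is unbounded near 0.
    Let U be linear and continuous; then |U f| <= C whenever the modular
    \int Phi(f) is at most 1.  On the atomless part of X, a function f with
    modular at most 1 splits by Sierpinski's theorem into two halves of equal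
    modular; k times a half again has modular at most 1, so |U f| <= 2 C / k,
    and iterating gives U f = 0.  On the atoms f is constant, which yields the
    partial sums of U f, and the tail of the modular over the remaining atoms
    tends to 0.  The formula for the norm rests on the concavity inequality
    |f_i| / Phi^-1(1/a_i) <= a_i Phi(f_i), whose right-hand sides sum to at
    most 1 on the unit ball. *)

(** * N*-functions *)


Section NStar.
Context (R : realType).
Implicit Types (p : R -> \bar R) (Phi : R -> R).
Local Notation leb := (@lebesgue_measure R).

(** Geometric decay, applied below with [q] equal to 2, [k] and [k / 2]. *)
Lemma exists_expr_lt (q x e : R) : 1 < q -> 0 < e -> exists n, x / q ^+ n < e.
Proof.
move=> q1 e0; have q0 : 0 < q by exact: lt_trans q1.
have : `|q^-1| < 1 by rewrite gtr0_norm ?invr_gt0// invf_lt1.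
move=> /cvg_expr h.
have /cvgrPdist_lt/(_ _ e0)[n _ /(_ n (leqnn n))] :
    (x * q^-1 ^+ n) @[n --> \oo] --> (0 : R).
  by rewrite -(mulr0 x); exact: (cvgM (cvg_cst x) h).
by rewrite /= sub0r normrN exprVn => /(le_lt_trans (ler_norm _)) ?; exists n.
Qed.

(** By monotonicity, the preimage of each closed upper ray is an interval. *)
Lemma ge0_nonincreasing_emeasurable p :
  (forall s t, 0 <= s -> s <= t -> (p t <= p s)%E) ->
  measurable_fun [set` `[(0:R), +oo[] p.
Proof.
move=> pni mD.
apply: (measurability _ (ErealGenCInfty.measurableE R)) => //.
move=> _ [_] [r] -> <-.
apply: is_interval_measurable => s t /=.
rewrite !in_itv/= !andbT => -[s0 ps] [t0 pt] u /andP[su ut].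
have u0 := le_trans s0 su.
by rewrite !in_itv/= !andbT; split => //; apply: (le_trans pt); exact: pni.
Qed.

Lemma NStar_even Phi x : NStar_function Phi -> Phi `|x| = Phi x.
Proof. by case=> p [_ _ _ pE]; apply: EFin_inj; rewrite -!pE normr_id. Qed.

Lemma NStar0 Phi : NStar_function Phi -> Phi 0 = 0.
Proof.
case=> p [_ _ _ pE]; apply: EFin_inj.
by rewrite -pE normr0 set_itv1 integral_set1.
Qed.

(** Concavity in usable form: the later concavity arguments rest on these slope bounds with a
    real-valued [p] and need no further integrals of the density. *)
Lemma NStar_chord Phi : NStar_function Phi ->
  exists p : R -> R, [/\ forall t, 0 < t -> 0 < p t,
     forall M, \forall t \near 0^'+, M < p t,
     forall t, 0 < t -> t * p t <= Phi t &
     forall s t, 0 < s -> s <= t ->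
       (t - s) * p t <= Phi t - Phi s <= (t - s) * p s].
Proof.
case=> p [[p0 _ pgt0 pni] poo _ pE].
have mp (a b : R) (x y : bool) : 0 <= a ->
    measurable_fun [set` Interval (BSide x a) (BSide y b)] p.
  move=> a0; apply: measurable_funS (ge0_nonincreasing_emeasurable pni) => //.
  move=> z /=; rewrite in_itv/= => /andP[+ _].
  by rewrite in_itv/= andbT; case: x => /= [|/ltW]; exact: le_trans.
have pge0 (a b : R) (x y : bool) : 0 <= a ->
    forall t, [set` Interval (BSide x a) (BSide y b)] t -> (0 <= p t)%E.
  move=> a0 z; rewrite /= in_itv/= => /andP[+ _] => az; apply: p0.
  by move: az; case: x => /= [|/ltW]; exact: le_trans.
(* Compare [p] with its values at the two endpoints. The lower bound admits a closed left endpoint,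
   since it is also applied on [[0, t]]. *)
have lo (a b : R) x : 0 <= a -> a <= b ->
    ((b - a)%:E * p b <= \int[leb]_(t in [set` Interval (BSide x a) (BRight b)]) p t)%E.
  move=> a0 ab.
  have -> : ((b - a)%:E * p b)%E =
    (\int[leb]_(t in [set` Interval (BSide x a) (BRight b)]) (cst (p b)) t)%E.
    rewrite integral_cst//= lebesgue_measure_itv/= lte_fin.
    rewrite muleC; case: ltP => //= ba.
    by rewrite (@le_anti _ _ a b) ?ab ?ba// subrr mule0.
  apply: ge0_le_integral => //.
  - by move=> z _; apply: p0; exact: le_trans ab.
  - exact: mp.
  - move=> z; rewrite /= in_itv/= => /andP[az zb]; apply: pni => //.
    by move: az; case: x => /= [|/ltW]; exact: le_trans.
have up (a b : R) : 0 <= a -> a <= b ->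
    (\int[leb]_(t in `]a, b]) p t <= (b - a)%:E * p a)%E.
  move=> a0 ab.
  have -> : ((b - a)%:E * p a)%E = (\int[leb]_(t in `]a, b]) (cst (p a)) t)%E.
    rewrite integral_cst//= lebesgue_measure_itv/= lte_fin.
    rewrite muleC; case: ltP => //= ba.
    by rewrite (@le_anti _ _ a b) ?ab ?ba// subrr mule0.
  apply: ge0_le_integral => //.
  - exact: pge0.
  - exact: mp.
  - move=> z; rewrite /= in_itv/= => /andP[/ltW az zb]; exact: pni.
have add (a b : R) : 0 <= a -> a <= b ->
    (Phi b)%:E = ((Phi a)%:E + \int[leb]_(t in `]a, b]) p t)%E.
  move=> a0 ab; rewrite -!pE !ger0_norm//; last exact: le_trans ab.
  have sU : [set` `[0, b]] = [set` `[0, a]] `|` [set` `]a, b]] :> set R.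
    by rewrite -itv_bndbnd_setU// bnd_simp.
  rewrite {1}sU ge0_integral_setU//.
  - by rewrite -sU; exact: mp.
  - by rewrite -sU; exact: pge0.
  - rewrite disj_set2E; apply/eqP/seteqP; split=> // z /= [].
    by rewrite !in_itv/= => /andP[_ za] /andP[/lt_geF]; rewrite za.
(* An infinite value [p t] would make the lower bound [t * p t] of the finite number [Phi t]
   infinite. *)
have fin t : 0 < t -> p t \is a fin_num.
  move=> t0; rewrite ge0_fin_numE ?p0 ?ltW// ltey; apply/eqP => pt.
  have := lo 0 t true (lexx _) (ltW t0).
  have := pE t; rewrite (ger0_norm (ltW t0)) => ->.
  by rewrite subr0 pt gt0_muley// lte_fin.
exists (fun t => fine (p t)); split.
- by move=> t t0; apply: fine_gt0; rewrite pgt0//=; have := fin _ t0; rewrite fin_numE => /andP[_]; rewrite ltey => ->.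
- move=> M; have /cvgeyPgt/(_ M) pM := poo.
  near=> t; have t0 : 0 < t by near: t; exact: nbhs_right_gt.
  by rewrite -lte_fin fineK ?fin//; near: t; exact: pM.
- move=> t t0; rewrite -lee_fin EFinM fineK ?fin// -pE (ger0_norm (ltW t0)).
  by have := lo 0 t true (lexx _) (ltW t0); rewrite subr0.
- move=> s t s0 st; have t0 := lt_le_trans s0 st.
  have E : (Phi t - Phi s)%:E = (\int[leb]_(z in `]s, t]) p z)%E.
    by rewrite EFinB (add s t) ?(ltW s0)// [X in (X - _)%E]addeC addeK.
  by rewrite -!lee_fin E !EFinM !fineK ?fin// lo ?up// ?(ltW s0).
Unshelve. all: by end_near. Qed.

Variables (Phi : R -> R) (k : R).
Hypothesis NPhi : NStar_function Phi.

Lemma NStar_lt x y : 0 <= x -> x < y -> Phi x < Phi y.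
Proof.
have [p [p0 _ pt pch]] := NStar_chord NPhi.
rewrite le_eqVlt => /predU1P[<-|x0] xy.
  by rewrite (NStar0 NPhi); apply: lt_le_trans (pt _ xy); rewrite mulr_gt0// p0.
have /andP[+ _] := pch _ _ x0 (ltW xy).
by rewrite -subr_gt0; apply: lt_le_trans; rewrite mulr_gt0 ?subr_gt0// p0// (lt_trans x0).
Qed.

Lemma NStar_gt0 x : 0 < x -> 0 < Phi x.
Proof. by move=> x0; rewrite -(NStar0 NPhi) NStar_lt. Qed.

Lemma NStar_ge0 x : 0 <= Phi x.
Proof.
rewrite -(NStar_even x NPhi).
have [->|x0] := eqVneq `|x| 0; first by rewrite NStar0.
by rewrite ltW// NStar_gt0// lt0r x0 normr_ge0.
Qed.

Lemma NStar_le x y : 0 <= x -> x <= y -> Phi x <= Phi y.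
Proof.
by move=> x0; rewrite le_eqVlt => /predU1P[->//|xy]; rewrite ltW// NStar_lt.
Qed.

Lemma NStar_leP x y : 0 <= x -> 0 <= y -> (Phi x <= Phi y) = (x <= y).
Proof.
move=> x0 y0; apply/idP/idP; last exact: NStar_le.
by apply: contraTT; rewrite -!ltNge; exact: NStar_lt.
Qed.

(** Concavity together with [Phi 0 = 0]: for positive [x] and [t], the slope [p (t * x)] is at most
    the mean slope on [[0, t * x]] and at least that on [[t * x, x]]. Eliminating it gives the
    inequality. *)
Lemma NStar_scale t x : 0 <= t <= 1 -> t * Phi x <= Phi (t * x).
Proof.
move=> /andP[t0 t1]; rewrite -(NStar_even x NPhi) -(NStar_even (t * x) NPhi).
rewrite normrM (ger0_norm t0); have := normr_ge0 x.
move: `|x| => {}x; rewrite le_eqVlt => /predU1P[<-|x0].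
  by rewrite mulr0 (NStar0 NPhi) mulr0.
move: t0; rewrite le_eqVlt => /predU1P[<-|t0]; first by rewrite !mul0r NStar_ge0.
have [p [p0 _ pt pch]] := NStar_chord NPhi.
have tx0 : 0 < t * x by rewrite mulr_gt0.
have txx : t * x <= x by rewrite ler_piMl// ltW.
have := pt _ tx0; have /andP[_] := pch _ _ tx0 txx.
have := NStar_gt0 x0.
move: (p (t * x)) (Phi (t * x)) (Phi x) => q a b b0 h1 h2.
have : (1 - t) * (t * x * q) <= (1 - t) * a by rewrite ler_wpM2l// subr_ge0.
nra.
Qed.

(** Apply [NStar_scale] to [x + y] with the factors [x / (x + y)] and [y / (x + y)], which sum to
    1. *)
Lemma NStar_add x y : 0 <= x -> 0 <= y -> Phi (x + y) <= Phi x + Phi y.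
Proof.
move=> x0 y0; have [xy0|xy0] := eqVneq (x + y) 0.
  by rewrite xy0 (NStar0 NPhi); apply: addr_ge0; exact: NStar_ge0.
have s0 : 0 < x + y by rewrite lt0r xy0 addr_ge0.
have h z : 0 <= z <= x + y -> z / (x + y) * Phi (x + y) <= Phi z.
  move=> /andP[z0 zs]; have := @NStar_scale (z / (x + y)) (x + y).
  by rewrite divfK ?gt_eqF//; apply; rewrite divr_ge0 ?(ltW s0)//= ler_pdivrMr// mul1r.
have -> : Phi (x + y) = x / (x + y) * Phi (x + y) + y / (x + y) * Phi (x + y).
  by rewrite -mulrDl -mulrDl divff ?mul1r.
by apply: lerD; apply: h; rewrite ?x0 ?y0/= ?lerDl ?lerDr.
Qed.

Lemma NStar_triangle x y : Phi (x + y) <= Phi x + Phi y.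
Proof.
rewrite -(NStar_even x NPhi) -(NStar_even y NPhi) -(NStar_even (x + y) NPhi).
by apply: le_trans (NStar_add _ _) => //; apply: NStar_le => //; exact: ler_normD.
Qed.

(** * Consequences of the relation [Phi (k * x) = 2 * Phi x]: growth, continuity and the inverse *)

Hypothesis k2 : 2 <= k.
Hypothesis Phik : forall x, 0 < x -> Phi (k * x) = 2 * Phi x.

Let k0 : 0 < k. Proof. by apply: lt_le_trans k2. Qed.

Lemma NStar_expk n x : Phi (k ^+ n * x) = 2 ^+ n * Phi x.
Proof.
rewrite -(NStar_even x NPhi) -(NStar_even (_ * x) NPhi).
rewrite normrM (@ger0_norm _ (k ^+ n)) ?exprn_ge0 ?(ltW k0)//; have := normr_ge0 x.
move: `|x| => {}x; rewrite le_eqVlt => /predU1P[<-|x0].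
  by rewrite mulr0 (NStar0 NPhi) mulr0.
elim: n => [|n IH]; first by rewrite !expr0 !mul1r.
by rewrite !exprS -!mulrA Phik ?IH// mulr_gt0// exprn_gt0.
Qed.

Lemma NStar_expVk n x : Phi (x / k ^+ n) = Phi x / 2 ^+ n.
Proof.
have kn0 : k ^+ n != 0 by rewrite gt_eqF// exprn_gt0.
rewrite -[in RHS](divfK kn0 x) [_ / _ * _]mulrC NStar_expk mulrAC divff ?mul1r//.
Qed.

(* For k = 2 the secant slopes Phi(2^-n) / 2^-n would be constant,
   although they dominate p(2^-n), which is unbounded. *)
Lemma NStar_k_gt2 : 2 < k.
Proof.
rewrite lt_neqAle k2 andbT; apply/eqP => kE.
have [p [_ poo pt _]] := NStar_chord NPhi.
have [e/= e0 pe] := poo (Phi 1).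
have q1 : 1 < 2 :> R by rewrite ltr1n.
have [n ne] := exists_expr_lt 1 q1 e0.
have t0 : 0 < 1 / 2 ^+ n :> R by rewrite divr_gt0// exprn_gt0.
have := pe (1 / 2 ^+ n); rewrite /ball/= sub0r normrN gtr0_norm// => /(_ ne t0).
rewrite -(ltr_pM2l t0) => /lt_le_trans /(_ (pt _ t0)).
by rewrite [in Phi (1 / _)]kE NStar_expVk mulrAC mul1r ltxx.
Qed.

(** Continuity at 0: take [del = 1 / k ^+ m], where [Phi] equals [Phi 1 / 2 ^+ m]. *)
Lemma NStar_small (e : R) : 0 < e -> exists2 del, 0 < del &
  forall x, `|x| < del -> Phi x < e.
Proof.
move=> e0; have q1 : 1 < 2 :> R by rewrite ltr1n.
have [m me] := exists_expr_lt (Phi 1) q1 e0.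
have d0 : 0 < 1 / k ^+ m by rewrite divr_gt0// exprn_gt0.
exists (1 / k ^+ m) => // x xd.
apply: le_lt_trans me; rewrite -NStar_expVk -(NStar_even x NPhi).
by apply: NStar_le => //; exact: ltW.
Qed.

(** Subadditivity reduces continuity at any point to continuity at 0, since [Phi x] and [Phi y]
    differ by at most [Phi (x - y)]. *)
Lemma NStar_continuous : continuous Phi.
Proof.
move=> x; apply/cvgrPdist_lt => e e0.
have [del d0 H] := NStar_small e0.
near=> y.
have yd : `|x - y| < del by near: y; exact: (nbhsx_ballx x del d0).
rewrite ltr_norml; apply/andP; split.
  rewrite ltrNl opprB ltrBlDr; apply: (@le_lt_trans _ _ (Phi (y - x) + Phi x)).
    by rewrite -{1}(subrK x y) NStar_triangle.
  by rewrite ltrD2r; apply: H; rewrite distrC.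
rewrite ltrBlDr; apply: (@le_lt_trans _ _ (Phi (x - y) + Phi y)).
  by rewrite -{1}(subrK y x) NStar_triangle.
by rewrite ltrD2r; exact: H.
Unshelve. all: by end_near. Qed.

Lemma NStar_measurable : measurable_fun setT Phi.
Proof. by apply: continuous_measurable_fun; exact: NStar_continuous. Qed.

(** The default value in [Phi_inv] is never taken for nonnegative [y]: [Phi] starts at 0, is
    continuous, and [Phi (k ^+ n) = 2 ^+ n * Phi 1] is unbounded. *)
Lemma Phi_invP y : 0 <= y -> 0 <= Phi_inv Phi y /\ Phi (Phi_inv Phi y) = y.
Proof.
move=> y0; rewrite /Phi_inv; case: xgetP => [x _ //|/(_ _) none]; exfalso.
have q1 : 1 < 2 :> R by rewrite ltr1n.
have P1 : 0 < Phi 1 by exact: NStar_gt0.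
have [n yn] := exists_expr_lt y q1 P1.
have kn0 : 0 <= k ^+ n by rewrite exprn_ge0// ltW.
have [||c] := @IVT R Phi 0 (k ^+ n) y kn0.
- by apply: continuous_subspaceT; exact: NStar_continuous.
- rewrite NStar0//; apply/andP; split; first by rewrite ge_min y0.
  rewrite le_max; apply/orP; right.
  by rewrite -[k ^+ n]mulr1 NStar_expk mulrC -ler_pdivrMr ?exprn_gt0// ltW.
- by rewrite in_itv/= => /andP[c0 _] cy; apply: (none c).
Qed.

Lemma Phi_inv_gt0 y : 0 < y -> 0 < Phi_inv Phi y.
Proof.
move=> y0; have [] := Phi_invP (ltW y0); rewrite le_eqVlt => /predU1P[<-|//].
by rewrite NStar0// => yE; rewrite yE ltxx in y0.
Qed.

End NStar.

(** * Finite atomless measures *)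


Section density_measure.
Local Open Scope ereal_scope.
Context d (T : measurableType d) (R : realType) (mu : {measure set T -> \bar R}).
Variable f : T -> \bar R.

(* The proofs mf and f0 are arguments so that the measure structure can be inferred. *)
Definition density_measure (mf : measurable_fun setT f) (f0 : forall x, 0 <= f x)
  (A : set T) : \bar R := \int[mu]_(x in A) f x.

Variables (mf : measurable_fun setT f) (f0 : forall x, 0 <= f x).
Local Notation nu := (density_measure mf f0).

Let nu0 : nu set0 = 0. Proof. exact: integral_set0. Qed.

Let nu_ge0 A : 0 <= nu A. Proof. exact: integral_ge0. Qed.

Let nu_sigma_additive : semi_sigma_additive nu.
Proof.
move=> F mF tF mUF; rewrite /density_measure ge0_integral_bigcup//.
  by apply: is_cvg_ereal_nneg_natsum_cond => n _ _; exact: integral_ge0.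
exact: measurable_funS mf.
Qed.

HB.instance Definition _ := isMeasure.Build _ _ _ nu
  nu0 nu_ge0 nu_sigma_additive.

End density_measure.

Section finite_measures.
Context d (T : measurableType d) (R : realType) (nu : {measure set T -> \bar R}).
Hypothesis nuT : (nu setT < +oo)%E.
Local Notation r A := (fine (nu A)).

Lemma finite_measure_lty A : measurable A -> (nu A < +oo)%E.
Proof. by move=> mA; apply: le_lt_trans nuT; apply: le_measure; rewrite ?inE. Qed.

Lemma finite_measureE A : measurable A -> nu A = (r A)%:E.
Proof. by move=> mA; rewrite fineK// ge0_fin_numE// finite_measure_lty. Qed.

Lemma fine_measure_le A B : measurable A -> measurable B -> A `<=` B -> r A <= r B.
Proof.
by move=> mA mB AB; rewrite -lee_fin -!finite_measureE// le_measure// inE.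
Qed.

Lemma fine_measureD A B : measurable A -> measurable B -> B `<=` A ->
  r (A `\` B) = r A - r B.
Proof.
move=> mA mB BA; have mAB := measurableD mA mB.
apply: EFin_inj; rewrite EFinB -!finite_measureE//.
by rewrite measureD ?(setIidr BA)//; exact: finite_measure_lty.
Qed.

(* Descending greedily: each step realises at least half of the decrease still available. *)
Lemma minimal_measure (C : set (set T)) E0 : C E0 -> C `<=` measurable ->
  (forall F : nat -> set T, (forall n, F n.+1 `<=` F n) -> (forall n, C (F n)) ->
     C (\bigcap_n F n)) ->
  exists2 E, C E & forall E', C E' -> E' `<=` E -> r E <= r E'.
Proof.
move=> CE0 Cm Ccap.
(* The membership [C E] is a premise inside the existential, so that [choice] yields a function on
   all sets that can be iterated. *)
have step E : exists E', C E -> [/\ C E', E' `<=` E &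
    forall E'', C E'' -> E'' `<=` E -> 2 * r E' - r E <= r E''].
  have [CE|nCE] := pselect (C E); last by exists E.
  pose S := [set r E'' | E'' in [set E'' | C E'' /\ E'' `<=` E]].
  have Slb : lbound S 0 by move=> _ [E'' _ <-]; exact: fine_ge0.
  have SE : S (r E) by exists E => //; split.
  have infS : has_inf S by split; [exists (r E)|exists 0].
  have infE : inf S <= r E by apply: inf_lbound => //; exists 0.
  have infle E'' : C E'' -> E'' `<=` E -> inf S <= r E''.
    by move=> CE'' E''E; apply: inf_lbound; [by exists 0|exists E'' => //; split].
  move: infE; rewrite le_eqVlt => /predU1P[infE|infE].
    exists E => _; split => // E'' CE'' E''E.
    by have := infle _ CE'' E''E; rewrite infE; lra.
  (* A competitor below the midpoint of [inf S] and [r E] satisfies [2 * r E' - r E < inf S]. *)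
  have e0 : 0 < (r E - inf S) / 2 by rewrite divr_gt0// subr_gt0.
  have [_ [E' [CE' E'E] <-] E'lt] := inf_adherent e0 infS.
  exists E' => _; split => // E'' CE'' E''E.
  by have := infle _ CE'' E''E; lra.
have [g gP] := choice step.
pose F n := iter n g E0.
have CF n : C (F n) by elim: n => //= n /gP[].
have FS n : F n.+1 `<=` F n by have [] := gP _ (CF n).
have CE := Ccap _ FS CF.
have mE := Cm _ CE.
exists (\bigcap_n F n) => // E' CE' E'E.
have cvF : r (F n) @[n --> \oo] --> r (\bigcap_n F n).
  apply: fine_cvg; rewrite -finite_measureE//.
  apply: nonincreasing_cvg_mu => //; last by apply/nonincreasing_seqP => n; apply/subsetPset.
    by apply: finite_measure_lty; exact: Cm.
  by move=> i; exact: Cm.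
have cvF1 : r (F n.+1) @[n --> \oo] --> r (\bigcap_n F n) by rewrite (cvg_shiftS (fun n => r (F n))).
(* Every term is at most [r E'], and the limit of the terms is the measure of the intersection. *)
have : 2 * r (F n.+1) - r (F n) @[n --> \oo] --> r (\bigcap_n F n).
  rewrite [X in _ --> X](_ : _ = 2 * r (\bigcap_n F n) - r (\bigcap_n F n)); last lra.
  exact: (cvgB (cvgM (cvg_cst (2 : R)) cvF1) cvF).
move/cvgr_to_le; apply; apply: nearW => n.
have [_ _] := gP _ (CF n); apply => //.
by apply: subset_trans E'E _; exact: bigcap_inf.
Qed.

Hypothesis nu_atomless : forall E, measurable E -> 0 < r E ->
  exists B, [/\ measurable B, B `<=` E & 0 < r B < r E].

(** Repeated cutting: of the two pieces [B] and [F \ B], both of positive measure, one has at most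
    half the measure of [F]. *)
Lemma atomless_small E e : measurable E -> 0 < r E -> 0 < e ->
  exists F, [/\ measurable F, F `<=` E & 0 < r F < e].
Proof.
move=> mE E0 e0.
have q1 : 1 < 2 :> R by rewrite ltr1n.
have [n ne] := exists_expr_lt (r E) q1 e0.
suff [F [mF FE /andP[F0 Fn]]] :
    exists F, [/\ measurable F, F `<=` E & 0 < r F <= r E / 2 ^+ n].
  by exists F; rewrite F0 (le_lt_trans Fn).
elim: n {ne} => [|n [F [mF FE /andP[F0 Fn]]]].
  by exists E; split => //; rewrite expr0 divr1 E0 lexx.
have [B [mB BF /andP[B0 BF1]]] := nu_atomless mF F0.
have rD := fine_measureD mF mB BF.
have Fn2 : r F / 2 <= r E / 2 ^+ n.+1.
  by rewrite exprSr invfM mulrA ler_pM2r.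
have [h|h] := leP (r B) (r F / 2).
  by exists B; split => //; [exact: subset_trans FE|rewrite B0 (le_trans h)].
exists (F `\` B); split; first exact: measurableD.
  by move=> x [/FE].
rewrite rD subr_gt0 BF1 (le_trans _ Fn2)//; lra.
Qed.

(* Sierpinski: a minimal set among those of measure at least t has measure t. *)
Lemma atomless_range t : 0 <= t <= r setT ->
  exists2 E, measurable E & r E = t.
Proof.
move=> /andP[t0 tT].
have [||F FS CF|E [mE tE] Emin] :=
    @minimal_measure [set E | measurable E /\ t <= r E] setT.
- by [].
- by move=> E [].
- have mF : measurable (\bigcap_n F n).
    by apply: bigcap_measurable => // n _; case: (CF n).
  split => //.
  have cvF : r (F n) @[n --> \oo] --> r (\bigcap_n F n).
    apply: fine_cvg; rewrite -finite_measureE//.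
    apply: nonincreasing_cvg_mu => //.
    + by apply: finite_measure_lty; case: (CF 0%N).
    + by move=> i; case: (CF i).
    + by apply/nonincreasing_seqP => n; apply/subsetPset.
  by move/cvgr_to_ge : cvF; apply; apply: nearW => n; case: (CF n).
(* If the measure of [E] exceeded [t], removing a piece smaller than the excess would contradict
   minimality. *)
- exists E => //; apply/eqP; rewrite eq_le tE andbT leNgt; apply/negP => tE'.
  have E0 : 0 < r E by exact: le_lt_trans tE'.
  have Et : 0 < r E - t by rewrite subr_gt0.
  have [G [mG GE /andP[G0 Gt]]] := atomless_small mE E0 Et.
  have rD := fine_measureD mE mG GE.
  have : r E <= r (E `\` G).
    apply: Emin; last by move=> x [].
    by split; [exact: measurableD|rewrite rD; lra].
  by rewrite rD; lra.
Qed.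

End finite_measures.

(** * Functions on atoms *)


Section atoms.
Context d (T : measurableType d) (R : realType) (mu : {measure set T -> \bar R}).

Lemma measurable_neq_cst (f : T -> R) c :
  measurable_fun setT f -> measurable [set x | f x != c].
Proof.
move=> mf; rewrite (_ : mkset _ = setT `&` f @^-1` (~` [set c])).
  by apply: mf => //; exact: measurableC.
by rewrite setTI; apply/seteqP; split => x /= /eqP.
Qed.

(** Were [mu A] infinite, each [A] intersected with a set of finite measure would be strictly
    smaller, hence null, and countably many such sets cover [A]. *)
Lemma atom_fin_num A : sigma_finite setT mu -> is_atom mu A -> mu A \is a fin_num.
Proof.
move=> [F FT mF] [mA A0 Aat]; rewrite ge0_fin_numE// ltey; apply/eqP => Aoo.
suff A00 : mu A = 0%E by rewrite A00 ltxx in A0.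
apply: measure_negligible => //.
have -> : A = \bigcup_n (A `&` F n) by rewrite -setI_bigcupr -FT setIT.
apply: negligible_bigcup => n; have [mFn Fn] := mF n.
apply/negligibleP; first exact: measurableI.
apply: Aat; [exact: measurableI|exact: subIsetl|].
rewrite Aoo; apply: le_lt_trans Fn; apply: le_measure; rewrite ?inE//.
exact: measurableI.
Qed.

(** The part of [A] in [B] is either smaller than [A], hence null, or of full measure; finiteness of
    [mu A] then makes the rest null by subtraction. *)
Lemma atom_dichotomy A B : is_atom mu A -> mu A \is a fin_num ->
  measurable B -> mu (A `&` B) = 0%E \/ mu (A `&` ~` B) = 0%E.
Proof.
move=> [mA A0 Aat] Afin mB.
have mAB := measurableI _ _ mA mB.
have [AB|AB] := ltP (mu (A `&` B)) (mu A).
  by left; apply: Aat => //; exact: subIsetl.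
right; apply/eqP; rewrite -measure_le0 -setDE measureD//; last by rewrite ltey_eq Afin.
by rewrite leeBlDr ?add0e// fin_numElt (lt_le_trans _ (measure_ge0 _ _))//=
   (le_lt_trans (measureIl mu mA mB))// ltey_eq Afin.
Qed.

(** Each sublevel set of [f] is null or conull in [A]; the constant is the infimum of the levels
    whose sublevel set is conull. *)
Lemma atom_const A (f : T -> R) : is_atom mu A -> mu A \is a fin_num ->
  measurable_fun setT f -> exists c, mu (A `&` [set x | f x != c]) = 0%E.
Proof.
move=> Aat Afin mf; have [mA A0 _] := Aat.
have mle (t : R) : measurable [set x | f x <= t].
  rewrite -[X in measurable X]setTI.
  by apply: measurable_fun_le => //; exact: measurable_cst.
have dich t := atom_dichotomy Aat Afin (mle t).
pose S := [set t | mu (A `&` ~` [set x | f x <= t]) = 0%E].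
have mAle t : measurable (A `&` [set x | f x <= t]) by exact: measurableI.
have mAgt t : measurable (A `&` ~` [set x | f x <= t]).
  by apply: measurableI => //; exact: measurableC.
(* Countably many sets that are null on [A] cannot cover the space. *)
have absurd (F : nat -> set T) : (forall n, measurable (F n)) ->
    (forall n, mu (A `&` F n) = 0%E) -> \bigcup_n F n = setT -> False.
  move=> mF F0 FT; suff A00 : mu A = 0%E by rewrite A00 ltxx in A0.
  apply: measure_negligible => //.
  have -> : A = \bigcup_n (A `&` F n) by rewrite -setI_bigcupr FT setIT.
  apply: negligible_bigcup => n.
  by apply/negligibleP; [exact: measurableI|exact: F0].
have archi (x : R) : exists n : nat, `|x| < n%:R.
  by exists (Num.truncn `|x|).+1; exact: truncnS_gt.
(* Otherwise all sets [f <= n] would be null on [A], although they cover the space. *)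
have Sne : S !=set0.
  apply: contrapT => S0; apply: (absurd (fun n => [set x | f x <= n%:R])) => //.
    by move=> n; have [//|h] := dich n%:R; case: S0; exists n%:R.
  apply/seteqP; split => // x _; have [n xn] := archi (f x).
  by exists n => //=; rewrite (le_trans (ler_norm _))// ltW.
(* Otherwise all sets [f > - n] would be null on [A], although they cover the space. *)
have Slb : has_lbound S.
  apply: contrapT => Slb; apply: (absurd (fun n => ~` [set x | f x <= - n%:R])).
  - by move=> n; exact: measurableC.
  - move=> n; have [h|//] := dich (- n%:R); exfalso; apply: Slb.
    exists (- n%:R) => t St; rewrite leNgt; apply/negP => tn.
    suff A00 : mu A = 0%E by rewrite A00 ltxx in A0.
    apply: measure_negligible => //.
    rewrite -(setIT A) -(setUCr [set x | f x <= t]) setIUr.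
    apply: negligibleU; apply/negligibleP => //.
    apply: subset_measure0 h => //.
    by move=> x [Ax /= xt]; split => //=; rewrite (le_trans xt)// ltW.
  - apply/seteqP; split => // x _; have [n xn] := archi (f x).
    exists n => //=; apply/negP; rewrite -ltNge ltrNl.
    by rewrite (le_lt_trans _ xn)// -normrN ler_norm.
have infS : has_inf S by split.
exists (inf S).
apply: measure_negligible.
  apply: measurableI => //.
  exact: measurable_neq_cst.
(* Where [f] differs from [inf S], it lies above or below by some [1 / (n + 1)]. Above, a level of
   [S] close to the infimum makes the set null; below, the dichotomy does, since no level under
   [inf S] is in [S]. *)
apply: (@negligibleS _ _ _ _ ((\bigcup_n (A `&` ~` [set x | f x <= inf S + n.+1%:R^-1]))
   `|` \bigcup_n (A `&` [set x | f x <= inf S - n.+1%:R^-1]))); last first.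
  apply: negligibleU; apply: negligible_bigcup => n; apply/negligibleP => //.
    have n0 : 0 < n.+1%:R^-1 :> R by rewrite invr_gt0.
    have [s Ss slt] := inf_adherent n0 infS.
    apply: subset_measure0 Ss => // x [Ax /= xt]; split => //=.
    by apply: contra_not xt => xs; rewrite (le_trans xs)// ltW.
  have [//|h] := dich (inf S - n.+1%:R^-1).
  have := inf_lbound Slb h; rewrite lerBrDr gerDl leNgt.
  by rewrite invr_gt0 ltr0n.
move=> x [Ax /= xc].
have [n nx] : exists n, n.+1%:R^-1 < `|f x - inf S|.
  have e0 : 0 < `|f x - inf S| by rewrite normr_gt0 subr_eq0.
  exists (Num.truncn (`|f x - inf S|^-1)).
  by rewrite invf_plt ?posrE// ?ltr0n// truncnS_gt.
have [xlt|xgt] := ltP (f x) (inf S).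
  right; exists n => //; split => //=; move: nx.
  rewrite distrC ger0_norm ?subr_ge0 ?(ltW xlt)//; move: (_^-1) => e; lra.
left; exists n => //; split => //=; apply/negP; rewrite -ltNge; move: nx.
rewrite ger0_norm ?subr_ge0//; move: (_^-1) => e; lra.
Qed.

Lemma ae_const_valP A (f : T -> R) : is_atom mu A -> mu A \is a fin_num ->
  measurable_fun setT f -> mu (A `&` [set x | f x != ae_const_val mu A f]) = 0%E.
Proof.
move=> Aat Afin /(atom_const Aat Afin)[c cP]; rewrite /ae_const_val.
by case: xgetP => // /(_ c).
Qed.

(** Two distinct a.e. values would present [A] as the union of two null sets. *)
Lemma ae_const_val_eq A (f : T -> R) c : is_atom mu A -> mu A \is a fin_num ->
  measurable_fun setT f -> mu (A `&` [set x | f x != c]) = 0%E ->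
  ae_const_val mu A f = c.
Proof.
move=> Aat Afin mf Ac; have Ac' := ae_const_valP Aat Afin mf.
have [mA A0 _] := Aat; apply/eqP/negPn/negP => ne.
suff A00 : mu A = 0%E by rewrite A00 ltxx in A0.
have mne (t : R) : measurable (A `&` [set x | f x != t]).
  by apply: measurableI => //; exact: measurable_neq_cst.
apply: measure_negligible => //.
apply: (@negligibleS _ _ _ _ ((A `&` [set x | f x != c]) `|`
   (A `&` [set x | f x != ae_const_val mu A f]))).
  move=> x Ax; have [fc|fc] := eqVneq (f x) c; last by left.
  by right; split => //=; rewrite fc eq_sym.
by apply: negligibleU; apply/negligibleP.
Qed.

End atoms.

(** * The modular and the quasi-norm *)


Section modular.
Context (R : realType) (d : measure_display) (T : measurableType d).
Context (mu : {measure set T -> \bar R}) (Phi : R -> R) (k : R).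
Hypothesis NPhi : NStar_function Phi.
Hypothesis k2 : 2 <= k.
Hypothesis Phik : forall x, 0 < x -> Phi (k * x) = 2 * Phi x.

Local Notation rho f := (\int[mu]_x (Phi (f x))%:E)%E.
Local Notation mfun f := (measurable_fun setT f).

Let k0 : 0 < k. Proof. exact: lt_le_trans k2. Qed.
Let kn0 n : 0 < k ^+ n. Proof. exact: exprn_gt0. Qed.
Let k1 : 1 < k. Proof. by apply: lt_le_trans k2; rewrite ltr1n. Qed.

Lemma measurable_NStar_comp (f : T -> R) : mfun f -> mfun (fun x => (Phi (f x))%:E).
Proof.
move=> mf; apply/measurable_EFinP; apply: (measurableT_comp _ mf).
exact: (NStar_measurable NPhi k2).
Qed.

Lemma modular_ge0 (f : T -> R) : (0 <= rho f)%E.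
Proof. by apply: integral_ge0 => x _; rewrite lee_fin (NStar_ge0 NPhi). Qed.

Lemma modular_le (f g : T -> R) : mfun f -> mfun g ->
  (forall x, `|f x| <= `|g x|) -> (rho f <= rho g)%E.
Proof.
move=> mf mg fg; apply: ge0_le_integral => //.
- by move=> x _; rewrite lee_fin (NStar_ge0 NPhi).
- exact: measurable_NStar_comp.
- exact: measurable_NStar_comp.
- move=> x _; rewrite lee_fin -(NStar_even (f x) NPhi) -(NStar_even (g x) NPhi).
  exact: (NStar_le NPhi).
Qed.

Lemma modular_expk n (f : T -> R) : mfun f ->
  rho (fun x => k ^+ n * f x) = ((2 ^+ n)%:E * rho f)%E.
Proof.
move=> mf; rewrite -ge0_integralZl_EFin ?exprn_ge0//.
- by apply: eq_integral => x _; rewrite (NStar_expk NPhi k2)// EFinM.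
- by move=> x _; rewrite lee_fin (NStar_ge0 NPhi).
- exact: measurable_NStar_comp.
Qed.

(** Dominating [a] by a power [k ^+ n] costs a factor [2 ^+ n] in the modular; sums are controlled
    by the subadditivity of [Phi]. *)
Lemma LPhi_lin a (f g : T -> R) : LPhi mu Phi f -> LPhi mu Phi g ->
  LPhi mu Phi (fun x => a * f x + g x).
Proof.
move=> [mf rf] [mg rg].
have maf : mfun (fun x => a * f x) by apply: measurable_funM => //; exact: measurable_cst.
have ml : mfun (fun x => a * f x + g x) by exact: measurable_funD.
split => //.
have [n an] := exists_expr_lt `|a| k1 ltr01.
have an' : `|a| <= k ^+ n by move: an; rewrite ltr_pdivrMr// mul1r => /ltW.
have raf : (rho (fun x => a * f x) < +oo)%E.
  apply: (@le_lt_trans _ _ (rho (fun x => k ^+ n * f x))).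
    apply: modular_le => // [|x].
      by apply: measurable_funM => //; exact: measurable_cst.
    by rewrite !normrM (gtr0_norm (kn0 n)) ler_wpM2r.
  by rewrite modular_expk// lte_mul_pinfty// ?lee_fin ?exprn_ge0.
apply: (@le_lt_trans _ _ (rho (fun x => a * f x) + rho g)%E); last exact: lte_add_pinfty.
rewrite -ge0_integralD//.
- apply: ge0_le_integral => //.
  + by move=> x _; rewrite lee_fin (NStar_ge0 NPhi).
  + exact: measurable_NStar_comp.
  + by apply: emeasurable_funD; exact: measurable_NStar_comp.
  + by move=> x _; rewrite -EFinD lee_fin (NStar_triangle NPhi).
- by move=> x _; rewrite lee_fin (NStar_ge0 NPhi).
- exact: measurable_NStar_comp.
- by move=> x _; rewrite lee_fin (NStar_ge0 NPhi).
- exact: measurable_NStar_comp.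
Qed.

Lemma LPhi0 : LPhi mu Phi (fun=> 0).
Proof.
split; first exact: measurable_cst.
by under eq_integral do rewrite (NStar0 NPhi); rewrite integral0 ltry.
Qed.

Lemma LPhiZ a (f : T -> R) : LPhi mu Phi f -> LPhi mu Phi (fun x => a * f x).
Proof.
move=> Lf; have := LPhi_lin a Lf LPhi0.
by under eq_fun do rewrite addr0.
Qed.

Lemma LPhiB (f g : T -> R) : LPhi mu Phi f -> LPhi mu Phi g ->
  LPhi mu Phi (fun x => f x - g x).
Proof.
move=> Lf Lg; have := LPhi_lin (-1) Lg Lf.
by under eq_fun do rewrite mulN1r addrC.
Qed.

Lemma modular_shrink (f : T -> R) (e : R) : LPhi mu Phi f -> 0 < e ->
  exists n, (rho (fun x => (k ^+ n)^-1 * f x)%R <= e%:E)%E.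
Proof.
move=> [mf rf] e0; have q1 : 1 < 2 :> R by rewrite ltr1n.
have [n ne] := exists_expr_lt (fine (rho f)) q1 e0.
exists n; have mg : mfun (fun x => (k ^+ n)^-1 * f x).
  by apply: measurable_funM => //; exact: measurable_cst.
have := modular_expk n mg.
under eq_integral do rewrite mulVKf ?gt_eqF//.
move=> E; rewrite -(@lee_pmul2l _ (2 ^+ n)%:E) ?lte_fin ?exprn_gt0//.
rewrite -E -EFinM -(@fineK _ (rho f)) ?ge0_fin_numE ?modular_ge0// lee_fin.
by rewrite mulrC -ler_pdivrMr ?exprn_gt0// ltW.
Qed.

Let norm_set (f : T -> R) :=
  [set l : R | 0 < l /\ (\int[mu]_x (Phi (`|f x| / l))%:E <= 1)%E].

Let norm_setE f l : 0 < l ->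
  (\int[mu]_x (Phi (`|f x| / l))%:E)%E = rho (fun x => l^-1 * f x).
Proof.
move=> l0; apply: eq_integral => x _; rewrite -(NStar_even (l^-1 * f x) NPhi).
by rewrite normrM (@gtr0_norm _ l^-1) ?invr_gt0// mulrC.
Qed.

Let norm_set_lb f : lbound (norm_set f) 0.
Proof. by move=> l [/ltW]. Qed.

Let norm_set_ne f : LPhi mu Phi f -> norm_set f !=set0.
Proof.
move=> Lf; have [n nf] := modular_shrink Lf ltr01.
by exists (k ^+ n); split => //; rewrite norm_setE.
Qed.

Lemma Phi_norm_le l (f : T -> R) : 0 < l ->
  (rho (fun x => l^-1 * f x)%R <= 1)%E -> Phi_norm mu Phi f <= l.
Proof.
move=> l0 rf; apply: inf_lbound; first by exists 0; exact: norm_set_lb.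
by split => //; rewrite norm_setE.
Qed.

Lemma Phi_norm_le1 (f : T -> R) : (rho f <= 1)%E -> Phi_norm mu Phi f <= 1.
Proof.
by move=> rf; apply: Phi_norm_le => //; under eq_integral do rewrite invr1 mul1r.
Qed.

(** Some admissible scale lies below [l], and the modular of [f / l] decreases as [l] grows. *)
Lemma Phi_norm_lt l (f : T -> R) : LPhi mu Phi f -> Phi_norm mu Phi f < l ->
  0 < l /\ (rho (fun x => l^-1 * f x)%R <= 1)%E.
Proof.
move=> Lf fl; have [s [s0 rs] sl] := inf_lt (norm_set_ne Lf) fl.
have l0 := lt_trans s0 sl; split => //; apply: le_trans rs; rewrite norm_setE//.
have mM c : mfun (fun x => c * f x).
  by apply: measurable_funM => //; case: Lf.
apply: modular_le => // x; rewrite !normrM ler_wpM2r//.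
rewrite !gtr0_norm ?invr_gt0// lef_pV2//; exact: ltW.
Qed.

(** Attainment of the infimum at 1 is obtained by approximation: every scale [1 + e] is admissible,
    and [NStar_scale] bounds the modular of [f] by [1 + e]. *)
Lemma modular_le1 (f : T -> R) : LPhi mu Phi f -> Phi_norm mu Phi f <= 1 ->
  (rho f <= 1)%E.
Proof.
move=> Lf f1; apply/lee_addgt0Pr => e e0; have [mf rf] := Lf.
have l1 : 1 < 1 + e by rewrite ltrDl.
have [l0 rl] := Phi_norm_lt Lf (le_lt_trans f1 l1).
have mg : mfun (fun x => (1 + e)^-1 * f x).
  by apply: measurable_funM => //; exact: measurable_cst.
apply: (@le_trans _ _ ((1 + e)%:E * rho (fun x => (1 + e)^-1 * f x)%R)%E).
  rewrite -ge0_integralZl_EFin ?(ltW l0)//.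
  - apply: ge0_le_integral => //.
    + by move=> x _; rewrite lee_fin (NStar_ge0 NPhi).
    + exact: measurable_NStar_comp.
    + by apply: measurable_funeM; exact: measurable_NStar_comp.
    + move=> x _; rewrite -EFinM lee_fin -ler_pdivrMl//.
      by apply: (NStar_scale NPhi); rewrite invr_ge0 (ltW l0) invf_le1// (ltW l1).
  - by move=> x _; rewrite lee_fin (NStar_ge0 NPhi).
  - exact: measurable_NStar_comp.
by rewrite -EFinD -[leRHS]mule1; apply: lee_wpmul2l => //; rewrite lee_fin ltW.
Qed.

(** [Phi] vanishes only at 0. This transfers positivity from [mu] to the measure with density
    [Phi (f x)]. *)
Lemma density_gt0 (f : T -> R) (B : set T) : mfun f -> measurable B -> (forall x, B x -> f x != 0) ->
  mu B != 0%E -> (0 < \int[mu]_(x in B) (Phi (f x))%:E)%E.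
Proof.
move=> mf mB f0 B0; rewrite lt0e integral_ge0 ?andbT; last first.
  by move=> x _; rewrite lee_fin (NStar_ge0 NPhi).
apply: contra_neq B0 => iB.
have mPf : measurable_fun B (fun x => (Phi (f x))%:E).
  by apply: measurable_funS (measurable_NStar_comp mf).
have /(ae_eq_integral_abs mu mB mPf) ae0 :
    (\int[mu]_(x in B) `|(Phi (f x))%:E| = 0)%E.
  rewrite -[RHS]iB; apply: eq_integral => x _.
  by rewrite gee0_abs// lee_fin (NStar_ge0 NPhi).
apply: measure_negligible => //; apply: negligibleS ae0 => x Bx /= /(_ Bx)[].
apply/eqP; rewrite -(NStar_even _ NPhi) gt_eqF//.
by rewrite (NStar_gt0 NPhi)// normr_gt0 f0.
Qed.

(** Multiplying by the indicator keeps the function total, so that [U] can be applied to it;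
    constant [f] gives multiples of indicators. *)
Definition restrict0 (E : set T) (f : T -> R) : T -> R := fun x => \1_E x * f x.

Lemma restrict0T f : restrict0 setT f = f.
Proof. by apply/funext => x; rewrite /restrict0 indicT mul1r. Qed.

Lemma restrict0U E F f : E `&` F = set0 ->
  restrict0 (E `|` F) f = (fun x => restrict0 E f x + restrict0 F f x).
Proof.
move=> EF; apply/funext => x; rewrite /restrict0 -mulrDl; congr (_ * _).
rewrite !indicE in_setU; case: (boolP (x \in E)) => xE; case: (boolP (x \in F)) => xF;
  rewrite /= ?addr0 ?add0r//.
by move: xE xF; rewrite !inE => xE xF; have : (E `&` F) x by []; rewrite EF.
Qed.

Lemma modular_restrict0 E f : measurable E -> mfun f ->
  rho (restrict0 E f) = (\int[mu]_(x in E) (Phi (f x))%:E)%E.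
Proof.
move=> mE mf; rewrite [RHS]integral_mkcond; apply: eq_integral => x _.
rewrite /restrict0 indicE patchE; case: (x \in E); rewrite ?mul1r//.
by rewrite mul0r (NStar0 NPhi).
Qed.

Lemma LPhi_restrict0 E f : measurable E -> LPhi mu Phi f -> LPhi mu Phi (restrict0 E f).
Proof.
move=> mE [mf rf]; have mEf : mfun (restrict0 E f) by exact: measurable_funM.
split=> //; apply: le_lt_trans rf; apply: modular_le => // x.
rewrite /restrict0 normrM ler_piMl// indicE; case: (x \in E); rewrite ?normr1//.
by rewrite normr0.
Qed.

Lemma LPhi_cst E c : measurable E -> mu E \is a fin_num ->
  LPhi mu Phi (restrict0 E (fun=> c)) /\
  rho (restrict0 E (fun=> c)) = ((Phi c)%:E * mu E)%E.
Proof.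
move=> mE Efin.
have rE : rho (restrict0 E (fun=> c)) = ((Phi c)%:E * mu E)%E.
  by rewrite modular_restrict0//= integral_cst.
split=> //; split; first exact: measurable_funM.
by rewrite rE ltey_eq fin_numM.
Qed.

End modular.

(** * Continuous linear functionals *)


Section functional.
Context (R : realType) (d : measure_display) (T : measurableType d).
Context (mu : {measure set T -> \bar R}) (Phi : R -> R) (k : R).
Hypothesis NPhi : NStar_function Phi.
Hypothesis k2 : 2 <= k.
Hypothesis Phik : forall x, 0 < x -> Phi (k * x) = 2 * Phi x.
Variable U : (T -> R) -> R.
Hypothesis Ulin : linear_on_LPhi mu Phi U.

Local Notation rho f := (\int[mu]_x (Phi (f x))%:E)%E.
Local Notation mfun f := (measurable_fun setT f).

Let k0 : 0 < k. Proof. exact: lt_le_trans k2. Qed.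
Let kn0 n : 0 < k ^+ n. Proof. exact: exprn_gt0. Qed.
Let k1 : 1 < k. Proof. by apply: lt_le_trans k2; rewrite ltr1n. Qed.

Lemma linear_LPhi0 : U (fun=> 0) = 0.
Proof.
have L0 := LPhi0 mu NPhi; have := Ulin 1 L0 L0.
under eq_fun do rewrite mulr0 addr0.
by rewrite mul1r => /eqP; rewrite -subr_eq0 opprD addNKr oppr_eq0 => /eqP.
Qed.

Lemma linear_LPhiZ a f : LPhi mu Phi f -> U (fun x => a * f x) = a * U f.
Proof.
move=> Lf; have := Ulin a Lf (LPhi0 mu NPhi).
by under eq_fun do rewrite addr0; rewrite linear_LPhi0 addr0.
Qed.

Lemma linear_LPhiD f g : LPhi mu Phi f -> LPhi mu Phi g ->
  U (fun x => f x + g x) = U f + U g.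
Proof.
move=> Lf Lg; have := Ulin 1 Lf Lg.
by under eq_fun do rewrite mul1r; rewrite mul1r.
Qed.

Lemma linear_LPhiB f g : LPhi mu Phi f -> LPhi mu Phi g ->
  U (fun x => f x - g x) = U f - U g.
Proof.
move=> Lf Lg; have := Ulin (-1) Lg Lf.
by under eq_fun do rewrite mulN1r addrC; rewrite mulN1r addrC.
Qed.

Lemma linear_LPhi_restrict0U E F f : measurable E -> measurable F ->
  E `&` F = set0 -> LPhi mu Phi f ->
  U (restrict0 (E `|` F) f) = U (restrict0 E f) + U (restrict0 F f).
Proof.
by move=> mE mF EF Lf; rewrite restrict0U// linear_LPhiD//; exact: (LPhi_restrict0 NPhi k2 Phik).
Qed.

(** Continuity at 0 with tolerance 1 gives a radius [del]; division by [k ^+ n] brings the modular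
    unit ball within it, so [C = k ^+ n] works. *)
Lemma continuous_LPhi_bounded : continuous_on_LPhi mu Phi U ->
  exists C, forall f, LPhi mu Phi f -> (rho f <= 1)%E -> `|U f| <= C.
Proof.
move=> Uc; have L0 := LPhi0 mu NPhi.
have [del d0 Ud] := Uc _ L0 1 ltr01.
have [n nd] := exists_expr_lt 1 k1 d0.
exists (k ^+ n) => f Lf rf.
have Lg := LPhiZ NPhi k2 Phik (k ^+ n)^-1 Lf.
have := Ud _ Lg; under eq_fun do rewrite subr0.
rewrite linear_LPhi0 subr0 linear_LPhiZ// normrM gtr0_norm ?invr_gt0// mulrC.
rewrite ltr_pdivrMr// mul1r => h; apply/ltW/h.
apply: le_lt_trans nd; rewrite div1r; apply: (Phi_norm_le NPhi); first by rewrite invr_gt0.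
by under eq_integral do rewrite mulKf ?invr_eq0 ?gt_eqF//.
Qed.

Lemma bounded_LPhi_continuous (M : R) :
  (forall f, LPhi mu Phi f -> Phi_norm mu Phi f <= 1 -> `|U f| <= M) ->
  continuous_on_LPhi mu Phi U.
Proof.
move=> UM f Lf e e0.
have M0 : 0 <= M.
  apply: le_trans (UM _ (LPhi0 mu NPhi) _); first exact: normr_ge0.
  apply: (Phi_norm_le1 NPhi).
  by under eq_integral do rewrite (NStar0 NPhi); rewrite integral0 lee01.
have M1 : 0 < M + 1 by rewrite ltr_wpDl.
(* The added 1 keeps the denominator positive when [M = 0] and makes the final inequality strict. *)
have d0 : 0 < e / (M + 1) by rewrite divr_gt0.
exists (e / (M + 1)) => // g Lg gf.
have Lh := LPhiB NPhi k2 Phik Lg Lf.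
have [_ rh] := Phi_norm_lt NPhi k2 Phik Lh gf.
rewrite -linear_LPhiB//; set h := (fun x => g x - f x) in Lh rh *.
have := UM _ (LPhiZ NPhi k2 Phik (e / (M + 1))^-1 Lh) (Phi_norm_le1 NPhi rh).
rewrite linear_LPhiZ// normrM gtr0_norm ?invr_gt0// ler_pdivrMl// => /le_lt_trans; apply.
by rewrite mulrAC ltr_pdivrMr// ltr_pM2l// ltrDl.
Qed.

Section bounded.
Variable C : R.
Hypothesis UC : forall f, LPhi mu Phi f -> (rho f <= 1)%E -> `|U f| <= C.

(** Multiplying [f] by [k ^+ n] multiplies its modular by [2 ^+ n], which brings it back under the
    bound [C]. *)
Lemma bounded_LPhi_small n f : LPhi mu Phi f -> (rho f <= (2 ^- n)%:E)%E ->
  `|U f| <= C / k ^+ n.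
Proof.
move=> Lf rf; have := UC (LPhiZ NPhi k2 Phik (k ^+ n) Lf).
rewrite linear_LPhiZ// normrM gtr0_norm// ler_pdivlMr// mulrC; apply.
rewrite (modular_expk mu NPhi k2 Phik)//; last by case: Lf.
apply: (le_trans (lee_wpmul2l _ rf)); first by rewrite lee_fin exprn_ge0.
by rewrite -EFinM divff// gt_eqF// exprn_gt0.
Qed.

(** Each halving of the modular improves the bound on [U] by the factor [k / 2], which exceeds 1;
    hence the bound tends to 0. *)
Lemma bounded_LPhi_atomless N f : measurable N ->
  (forall E, measurable E -> E `<=` N -> ~ is_atom mu E) ->
  LPhi mu Phi f -> (forall x, ~ N x -> f x = 0) -> U f = 0.
Proof.
move=> mN Nat.
have K1 : 1 < k / 2 by rewrite ltr_pdivlMr// mul1r (NStar_k_gt2 NPhi k2 Phik).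
have K0 : 0 < k / 2 by exact: lt_trans K1.
have claim n g : LPhi mu Phi g -> (forall x, ~ N x -> g x = 0) ->
    (rho g <= 1)%E -> `|U g| <= C / (k / 2) ^+ n.
  elim: n g => [g Lg gN rg|n IH g Lg gN rg]; first by rewrite expr0 divr1 UC.
  have [mg _] := Lg.
  pose mPg := measurable_NStar_comp NPhi k2 Phik mg.
  have Pg0 x : (0 <= (Phi (g x))%:E)%E by rewrite lee_fin (NStar_ge0 NPhi).
  pose nu : {measure set T -> \bar R} := density_measure mu mPg Pg0.
  have nuE E : nu E = (\int[mu]_(x in E) (Phi (g x))%:E)%E by [].
  have nu1 : (nu setT <= 1)%E by [].
  have nuT : (nu setT < +oo)%E by rewrite (le_lt_trans nu1)// ltry.
  (* The part [E'] of [E] where [g] is nonzero lies in [N] and has positive [mu]-measure. As it is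
     no atom, it contains a [B] of positive and strictly smaller [mu]-measure. *)
  have nu_atomless E : measurable E -> 0 < fine (nu E) ->
      exists B, [/\ measurable B, B `<=` E & 0 < fine (nu B) < fine (nu E)].
    move=> mE E0.
    have mg0 := measurable_neq_cst 0 mg.
    pose E' := E `&` [set x | g x != 0].
    have mE' : measurable E' by exact: measurableI.
    have E'N : E' `<=` N.
      by move=> x [_ /= /eqP gx]; apply: contrapT => /gN.
    have nupos B : measurable B -> B `<=` E' -> mu B != 0%E -> 0 < fine (nu B).
      move=> mB BE' B0; rewrite -lte_fin -(finite_measureE nuT)// nuE.
      by apply: (density_gt0 NPhi k2 Phik) => // x /BE'[].
    have E'0 : mu E' != 0%E.
      apply/eqP => E'0; move: E0; rewrite nuE.
      rewrite (ge0_negligible_integral mE' mE)//; last first.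
        exact: measurable_funS (measurable_NStar_comp NPhi k2 Phik mg).
      rewrite (eq_integral (cst 0%E)) ?integral0 ?ltxx//.
      move=> x; rewrite inE => -[Ex E'x]; have [gx|gx] := eqVneq (g x) 0.
        by rewrite gx (NStar0 NPhi).
      by case: E'x; split.
    have [B [mB BE' BE B0]] : exists B,
        [/\ measurable B, B `<=` E', (mu B < mu E')%E & mu B != 0%E].
      apply: contrapT => noB; apply: (Nat _ mE' E'N); split => //.
        by rewrite lt0e E'0 measure_ge0.
      move=> B mB BE' BlE'; apply/eqP; apply: contrapT => B0; apply: noB.
      by exists B; split => //; apply/negP.
    exists B; split => //; first by move=> x /BE'[].
    rewrite nupos//=; apply: (@lt_le_trans _ _ (fine (nu E'))); last first.
      by apply: (fine_measure_le nuT) => // x [].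
    have mD := measurableD mE' mB.
    rewrite -subr_gt0 -(fine_measureD nuT)//; apply: nupos => //.
    (* The remainder [E' \ B] is not [mu]-null either, so it has positive [nu]-measure as well. *)
    have UE : mu (B `|` (E' `\` B)) = (mu B + mu (E' `\` B))%E.
      by apply: measureU => //; exact: setDIK.
    by apply/eqP => D0; move: BE; rewrite -(setDUK BE') UE D0 adde0 ltxx.
  have [|E mE rE] := atomless_range nuT nu_atomless (t := fine (nu setT) / 2).
    have := fine_ge0 (measure_ge0 nu setT); lra.
  have mCE := measurableC mE.
  have rCE : fine (nu (~` E)) = fine (nu setT) / 2.
    by rewrite -setTD (fine_measureD nuT)// rE; lra.
  (* On half of the mass, multiplication by [k] doubles the modular back to at most 1, so the
     induction hypothesis applies. *)
  have half F : measurable F -> fine (nu F) = fine (nu setT) / 2 ->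
      `|U (restrict0 F g)| <= C / (k / 2) ^+ n / k.
    move=> mF rF; have LF := LPhi_restrict0 NPhi k2 Phik mF Lg.
    have := IH _ (LPhiZ NPhi k2 Phik k LF).
    rewrite linear_LPhiZ// normrM gtr0_norm// => h.
    rewrite ler_pdivlMr// mulrC; apply: h.
      by move=> x Nx; rewrite /restrict0 gN// !mulr0.
    rewrite -(expr1 k) (modular_expk mu NPhi k2 Phik)//; last by case: LF.
    rewrite (modular_restrict0 mu NPhi)// -nuE (finite_measureE nuT)// rF expr1 -EFinM.
    by rewrite mulrC divfK// -(finite_measureE nuT).
  rewrite -(restrict0T g) -(setUv E) linear_LPhi_restrict0U//; last exact: setICr.
  apply: le_trans (ler_normD _ _) _.
  apply: le_trans (lerD (half _ mE rE) (half _ mCE rCE)) _.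
  rewrite exprS invfM mulrCA; set c := _ / (k / 2) ^+ n.
  have -> : (k / 2)^-1 * c = 2 * (c / k) by rewrite invf_div mulrAC mulrA.
  by move: (c / k) => x; lra.
have claim0 g : LPhi mu Phi g -> (forall x, ~ N x -> g x = 0) ->
    (rho g <= 1)%E -> U g = 0.
  move=> Lg gN rg; apply/eqP; rewrite -normr_le0; apply/ler_addgt0Pl => e e0.
  have [n ne] := exists_expr_lt C K1 e0.
  by rewrite addr0 (le_trans (claim n _ Lg gN rg))// ltW.
(* A general [f] is first scaled into the modular unit ball. *)
move=> Lf fN; have [n rn] := modular_shrink NPhi k2 Phik Lf ltr01.
have := claim0 _ (LPhiZ NPhi k2 Phik (k ^+ n)^-1 Lf) _ rn.
rewrite linear_LPhiZ// => h; apply/eqP.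
have /eqP : (k ^+ n)^-1 * U f = 0 by apply: h => x /fN ->; rewrite mulr0.
by rewrite mulf_eq0 invr_eq0 gt_eqF.
Qed.

End bounded.
End functional.

(** * Sums over the family of atoms *)


Section atom_sums.
Context (R : realType) (d : measure_display) (T : measurableType d).
Context (mu : {measure set T -> \bar R}) (Phi : R -> R) (k : R).
Variables (I : set nat) (A : nat -> set T).
Hypothesis sfmu : sigma_finite setT mu.
Hypothesis NPhi : NStar_function Phi.
Hypothesis k2 : 2 <= k.
Hypothesis Phik : forall x, 0 < x -> Phi (k * x) = 2 * Phi x.
Hypothesis Afam : atom_family mu I A.

Local Notation rho f := (\int[mu]_x (Phi (f x))%:E)%E.
Local Notation mfun f := (measurable_fun setT f).
Local Notation a i := (fine (mu (A i))).
Local Notation b i := (Phi_inv Phi (1 / fine (mu (A i)))).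
Local Notation v f i := (ae_const_val mu (A i) f).

Lemma family_atom i : I i -> is_atom mu (A i).
Proof. by case: Afam => h _ _ /h. Qed.

Lemma family_measurable i : I i -> measurable (A i).
Proof. by move=> /family_atom[]. Qed.

Lemma family_fin_num i : I i -> mu (A i) \is a fin_num.
Proof. by move=> /family_atom; exact: atom_fin_num. Qed.

Lemma family_fine_gt0 i : I i -> 0 < a i.
Proof.
move=> Ii; rewrite -lte_fin fineK ?family_fin_num//.
by have [] := family_atom Ii.
Qed.

Lemma family_Phi_inv i : I i -> 0 < b i /\ Phi (b i) = 1 / a i.
Proof.
move=> Ii; have a0 : 0 < 1 / a i by rewrite divr_gt0// family_fine_gt0.
split; first exact: (Phi_inv_gt0 NPhi k2 Phik).
by have [] := Phi_invP NPhi k2 Phik (ltW a0).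
Qed.

Lemma family_ae_const i (f : T -> R) : I i -> mfun f ->
  mu (A i `&` [set x | f x != v f i]) = 0%E.
Proof.
by move=> Ii; apply: ae_const_valP; [exact: family_atom|exact: family_fin_num].
Qed.

Lemma family_ae_const_lin i c (f g : T -> R) : I i -> mfun f -> mfun g ->
  v (fun x => c * f x + g x) i = c * v f i + v g i.
Proof.
move=> Ii mf mg; apply: ae_const_val_eq.
- exact: family_atom.
- exact: family_fin_num.
- by apply: measurable_funD => //; apply: measurable_funM => //; exact: measurable_cst.
- have mA := family_measurable Ii.
  have mne (h : T -> R) t : mfun h -> measurable (A i `&` [set x | h x != t]).
    by move=> mh; apply: measurableI => //; exact: measurable_neq_cst.
  apply: measure_negligible.
    by apply: mne; apply: measurable_funD => //; apply: measurable_funM => //; exact: measurable_cst.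
  apply: (@negligibleS _ _ _ _ ((A i `&` [set x | f x != v f i]) `|`
      (A i `&` [set x | g x != v g i]))).
    move=> x [Ax /= fg]; have [fx|fx] := eqVneq (f x) (v f i); last by left.
    by right; split => //=; apply: contra_neq fg => ->; rewrite fx.
  by apply: negligibleU; apply/negligibleP; (try exact: mne); exact: family_ae_const.
Qed.

Lemma family_ae_restrict0 i (f : T -> R) : I i -> mfun f ->
  {ae mu, forall x, restrict0 (A i) f x = restrict0 (A i) (fun=> v f i) x}.
Proof.
move=> Ii mf; have mA := family_measurable Ii.
exists (A i `&` [set x | f x != v f i]); split.
- by apply: measurableI => //; exact: measurable_neq_cst.
- exact: family_ae_const.
- move=> x /=; rewrite /restrict0 indicE; case: (boolP (x \in A i)) => [|_].
    by rewrite inE => Ax; rewrite !mul1r => /eqP.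
  by rewrite !mul0r.
Qed.

Lemma family_modular i (f : T -> R) : I i -> mfun f ->
  (\int[mu]_(x in A i) (Phi (f x))%:E = (Phi (v f i) * a i)%:E)%E.
Proof.
move=> Ii mf; have mA := family_measurable Ii.
have mPf := measurable_NStar_comp NPhi k2 Phik mf.
rewrite (@ge0_ae_eq_integral _ _ _ mu (A i) _ (cst (Phi (v f i))%:E))//.
- by rewrite integral_cst// EFinM fineK// family_fin_num.
- exact: measurable_funS mPf.
- by move=> x _; rewrite lee_fin (NStar_ge0 NPhi).
- by move=> x _; rewrite lee_fin (NStar_ge0 NPhi).
- exists (A i `&` [set x | f x != v f i]); split.
  + by apply: measurableI => //; exact: measurable_neq_cst.
  + exact: family_ae_const.
  + move=> x /= /not_implyP[Ax fx]; split => //=.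
    by apply/eqP => fv; apply: fx; rewrite fv.
Qed.

(** Indices outside [I] contribute the empty set, so [V n] is the complement of the atoms with index
    below [n], and [V 0] is the whole space. *)
Let A' i := if i \in I then A i else set0.
Let V n := \bigcap_(i < n) ~` A' i.

Let mA' i : measurable (A' i).
Proof. by rewrite /A'; case: ifPn => // /set_mem/family_measurable. Qed.

Let mV n : measurable (V n).
Proof. by apply: bigcap_measurableType => i _; exact: measurableC. Qed.

Let V0 : V 0 = setT.
Proof. by apply/seteqP; split => // x _ i. Qed.

(** Peels off one atom; pairwise disjointness places [A' n] inside [V n]. *)
Let VS n : V n = A' n `|` V n.+1.
Proof.
apply/seteqP; split => x.
  move=> Vx; have [Ax|Ax] := pselect (A' n x); [by left|right => i /=].
  by rewrite ltnS leq_eqVlt => /predU1P[->//|/Vx].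
case=> [Ax i /= ni Aix|Vx i /= ni]; last by apply: Vx => /=; exact: leqW.
move: Ax Aix; rewrite /A'; case: ifPn => // /set_mem In; case: ifPn => // /set_mem Ii.
have [_ dis _] := Afam => Anx Aix.
have ne : i <> n by move=> E; rewrite E ltnn in ni.
by have : (A i `&` A n) x by []; rewrite dis.
Qed.

Let VD n : A' n `&` V n.+1 = set0.
Proof. by apply/seteqP; split => // x [Ax Vx]; exact: (Vx n (ltnSn n) Ax). Qed.

(** An atom in the remainder would agree with some [A i] up to a null set while being disjoint from
    it, so it would itself be null. *)
Lemma family_atomless E : measurable E -> E `<=` \bigcap_n V n -> ~ is_atom mu E.
Proof.
move=> mE EV Eat; have [_ E0 _] := Eat.
have [_ _ /(_ _ Eat)[i [[Ii Ei] _]]] := Afam.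
suff E00 : mu E = 0%E by rewrite E00 ltxx in E0.
have mA := family_measurable Ii.
apply: subset_measure0 Ei => //.
  by apply: measurableU; exact: measurableD.
move=> x Ex; left; split => // Aix; apply: (EV x Ex i.+1 Logic.I i (ltnSn i)).
by rewrite /A' mem_set.
Qed.

(* Each term is at most the modular of f on A_i: Phi is concave and Phi (b i) = 1 / a i. *)
Lemma family_sum_le1 f n : LPhi mu Phi f -> (rho f <= 1)%E ->
  \sum_(0 <= i < n | i \in I) `|v f i| / b i <= 1.
Proof.
move=> [mf _] rf.
have mPf := measurable_NStar_comp NPhi k2 Phik mf.
have P0 E x : E x -> (0 <= (Phi (f x))%:E)%E by rewrite lee_fin (NStar_ge0 NPhi).
have le1 E : measurable E -> (\int[mu]_(x in E) (Phi (f x))%:E <= 1)%E.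
  by move=> mE; apply: le_trans rf; apply: ge0_subset_integral => // x; exact: P0.
(* The induction carries the modular over the remaining set [V n] along with the sum. *)
suff : ((\sum_(0 <= i < n | i \in I) `|v f i| / b i)%:E +
    \int[mu]_(x in V n) (Phi (f x))%:E <= rho f)%E.
  move=> h; rewrite -lee_fin; apply: le_trans rf; apply: le_trans h.
  by rewrite leeDl//; apply: integral_ge0 => x; exact: P0.
elim: n => [|n IH]; first by rewrite big_geq// V0 add0e.
apply: le_trans IH; rewrite [in leRHS](VS n) ge0_integral_setU//; last 3 first.
- exact: measurable_funS mPf.
- by move=> x; exact: P0.
- by rewrite disj_set2E VD.
rewrite big_mkcond big_nat_recr//= -big_mkcond EFinD -addeA leeD2l// leeD2r//.
rewrite /A'; case: ifPn => [/set_mem In|_]; last by rewrite integral_set0.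
have := le1 _ (family_measurable In); rewrite family_modular// !lee_fin.
have a0 := family_fine_gt0 In.
have := family_Phi_inv In; set bn := b n => -[b0 Pb].
(* Modular at most 1 on the atom forces the value of [f] there to be at most [bn] in absolute value,
   so the quotient is an admissible factor in [NStar_scale]. *)
rewrite -(ler_pdivlMr _ _ a0) -Pb -(NStar_even _ NPhi) (NStar_leP NPhi) ?(ltW b0)// => vb.
have t01 : 0 <= `|v f n| / bn <= 1.
  by rewrite divr_ge0 ?(ltW b0)//= ler_pdivrMr// mul1r.
have := NStar_scale NPhi bn t01.
by rewrite divfK ?gt_eqF// Pb mulrA mulr1 ler_pdivrMr.
Qed.

Local Notation sup_coef u := (ereal_sup [set (`|u i| * b i)%:E | i in I]).

(** With [r] the supremum, each term of the sum is at most [r] times the quotient bounded in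
    [family_sum_le1]; the estimate survives the limit. *)
Lemma op_norm_le_sup (U : (T -> R) -> R) (u : nat -> R) : I !=set0 ->
  (forall f, LPhi mu Phi f ->
     (fun n => \sum_(0 <= i < n | i \in I) u i * v f i) @ \oo --> U f) ->
  (op_norm mu Phi U <= sup_coef u)%E.
Proof.
move=> [i0 Ii0] Ucvg; apply: ge_ereal_sup => _ [f [Lf f1] <-].
have le_sup i : I i -> ((`|u i| * b i)%:E <= sup_coef u)%E.
  by move=> Ii; apply: ereal_sup_ubound; exists i.
(* Nonemptiness of [I] excludes the value [-oo], the supremum of the empty set. *)
have : (0 <= sup_coef u)%E.
  apply: le_trans (le_sup _ Ii0); rewrite lee_fin mulr_ge0//.
  by have [/ltW] := family_Phi_inv Ii0.
move: le_sup; case: (sup_coef u) => [r|_ _|//]; last by rewrite leey.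
move=> le_sup; rewrite lee_fin => r0; rewrite lee_fin.
have rf := modular_le1 NPhi k2 Phik Lf f1.
have h : `|\sum_(0 <= i < n | i \in I) u i * v f i| @[n --> \oo] --> `|U f|.
  exact: cvg_norm (Ucvg _ Lf).
apply: (@cvgr_to_le _ _ _ _ _ _ _ h); apply: nearW => n.
apply: le_trans (ler_norm_sum _ _ _) _.
apply: (@le_trans _ _ (r * \sum_(0 <= i < n | i \in I) `|v f i| / b i)); last first.
  by rewrite -[leRHS]mulr1 ler_wpM2l// family_sum_le1.
rewrite mulr_sumr; apply: ler_sum => i /set_mem Ii.
have [b0 _] := family_Phi_inv Ii; have := le_sup _ Ii; rewrite lee_fin => ur.
by rewrite normrM mulrCA mulrC ler_wpM2l// ler_pdivlMr.
Qed.

Variable U : (T -> R) -> R.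
Hypothesis Uae : forall f g, LPhi mu Phi f -> LPhi mu Phi g ->
  {ae mu, forall x, f x = g x} -> U f = U g.
Hypothesis Ulin : linear_on_LPhi mu Phi U.

Let u i := U (restrict0 (A i) (fun=> 1)).

(** On the atom, [f] may be replaced by its a.e. constant value, because [U] respects a.e.
    equality. *)
Lemma family_functional i f : I i -> LPhi mu Phi f ->
  U (restrict0 (A i) f) = u i * v f i.
Proof.
move=> Ii Lf; have mA := family_measurable Ii; have Afin := family_fin_num Ii.
have [L1 _] := LPhi_cst NPhi 1 mA Afin.
have [Lv _] := LPhi_cst NPhi (v f i) mA Afin.
rewrite (@Uae _ (restrict0 (A i) (fun=> v f i)))//; first last.
  by apply: family_ae_restrict0 => //; case: Lf.
  exact: (LPhi_restrict0 NPhi k2 Phik).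
rewrite (_ : restrict0 _ _ = (fun x => v f i * restrict0 (A i) (fun=> 1) x)); last first.
  by apply/funext => x; rewrite /restrict0 mulr1 mulrC.
by rewrite (linear_LPhiZ NPhi Ulin)// mulrC.
Qed.

(** The test function is [b i] times the indicator of [A i]; its modular is
    [Phi (b i) * a i = 1]. *)
Lemma op_norm_ge_sup : (sup_coef u <= op_norm mu Phi U)%E.
Proof.
apply: ge_ereal_sup => _ [i Ii <-]; have mA := family_measurable Ii.
have Afin := family_fin_num Ii; have [b0 Pb] := family_Phi_inv Ii.
have [L1 _] := LPhi_cst NPhi 1 mA Afin; have [Lb rb] := LPhi_cst NPhi (b i) mA Afin.
apply: ereal_sup_ubound; exists (restrict0 (A i) (fun=> b i)).
  split => //; apply: (Phi_norm_le1 NPhi).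
  rewrite rb Pb -(fineK Afin) -EFinM mulrC div1r divff//.
  by rewrite gt_eqF// family_fine_gt0.
rewrite (_ : restrict0 _ _ = (fun x => b i * restrict0 (A i) (fun=> 1) x)); last first.
  by apply/funext => x; rewrite /restrict0 mulr1 mulrC.
by rewrite (linear_LPhiZ NPhi Ulin)// normrM (gtr0_norm b0) mulrC.
Qed.

Variable C : R.
Hypothesis UC : forall f, LPhi mu Phi f -> (rho f <= 1)%E -> `|U f| <= C.

Lemma family_functional_split f n : LPhi mu Phi f ->
  U f = \sum_(0 <= i < n | i \in I) u i * v f i + U (restrict0 (V n) f).
Proof.
move=> Lf; elim: n => [|n ->]; first by rewrite big_geq// V0 restrict0T add0r.
rewrite [in LHS](VS n) (linear_LPhi_restrict0U NPhi k2 Phik Ulin)//.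
rewrite [in RHS]big_mkcond big_nat_recr//= -big_mkcond -addrA; congr (_ + (_ + _)).
rewrite /A'; case: ifPn => [/set_mem In|_]; first exact: family_functional.
rewrite (_ : restrict0 _ _ = (fun=> 0)) ?(linear_LPhi0 NPhi Ulin)//.
by apply/funext => x; rewrite /restrict0 indicE in_set0 mul0r.
Qed.

(** After [n] steps the error is [U] on [V n]. It vanishes on the atomless intersection [N], and the
    rest [V n \ N] decreases to the empty set. *)
Lemma family_functional_cvg f : LPhi mu Phi f ->
  (fun n => \sum_(0 <= i < n | i \in I) u i * v f i) @ \oo --> U f.
Proof.
move=> Lf; have [mf rf] := Lf; pose N := \bigcap_n V n.
have mN : measurable N by exact: bigcap_measurableType.
have VN n : V n = N `|` (V n `\` N) by rewrite setDUK// => x; apply.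
have UN : U (restrict0 N f) = 0.
  apply: (bounded_LPhi_atomless NPhi k2 Phik Ulin UC mN) => //.
  - exact: family_atomless.
  - exact: (LPhi_restrict0 NPhi k2 Phik).
  - by move=> x Nx; rewrite /restrict0 indicE memNset// mul0r.
pose mPf := measurable_NStar_comp NPhi k2 Phik mf.
have Pf0 x : (0 <= (Phi (f x))%:E)%E by rewrite lee_fin (NStar_ge0 NPhi).
pose nu : {measure set T -> \bar R} := density_measure mu mPf Pf0.
have nuT : (nu setT < +oo)%E by [].
have mD n : measurable (V n `\` N) by exact: measurableD.
(* Continuity from above for the finite measure with density [Phi (f x)]. *)
have cvD : nu (V n `\` N) @[n --> \oo] --> 0%E.
  rewrite -(measure0 nu) (_ : set0 = \bigcap_n (V n `\` N)); last first.
    apply/seteqP; split => // x Vx; have [_ Nx] := Vx 0%N Logic.I.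
    by apply: Nx => n _; have [] := Vx n Logic.I.
  apply: nonincreasing_cvg_mu => //.
  - exact: (finite_measure_lty nuT).
  - exact: bigcap_measurableType.
  - apply/nonincreasing_seqP => n; apply/subsetPset; apply: setSD.
    by rewrite [X in _ `<=` X](VS n); exact: subsetUr.
apply/cvgrPdist_lt => e e0.
have k1 : 1 < k by apply: lt_le_trans k2; rewrite ltr1n.
have [m me] := exists_expr_lt C k1 e0.
have m0 : 0 < 2 ^- m :> R by rewrite invr_gt0 exprn_gt0.
(* Once the modular over the tail is below [2 ^- m], the functional there is at most [C / k ^+ m],
   which is below [e]. *)
have : \forall n \near \oo, (nu (V n `\` N) < (2 ^- m)%:E)%E.
  have cvF : fine (nu (V n `\` N)) @[n --> \oo] --> (0 : R) by exact: fine_cvg.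
  move/cvgrPdist_lt/(_ _ m0) : cvF; apply: filterS => n.
  rewrite sub0r normrN => /(le_lt_trans (ler_norm _)).
  by rewrite (finite_measureE nuT)// lte_fin.
apply: filterS => n nun.
rewrite (family_functional_split n Lf) addrAC subrr add0r.
rewrite {1}(VN n) (linear_LPhi_restrict0U NPhi k2 Phik Ulin)//; last exact: setDIK.
rewrite UN add0r; apply: le_lt_trans me.
apply: (bounded_LPhi_small NPhi k2 Phik Ulin UC).
  exact: (LPhi_restrict0 NPhi k2 Phik).
by rewrite (modular_restrict0 mu NPhi)// ltW.
Qed.

End atom_sums.

(** * The equivalence of continuity with the series representation *)

Lemma op_norm_le (R : realType) (d : measure_display) (T : measurableType d)
    (mu : {measure set T -> \bar R}) (Phi : R -> R) (U : (T -> R) -> R) f :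
  LPhi mu Phi f -> Phi_norm mu Phi f <= 1 -> (`|U f|%:E <= op_norm mu Phi U)%E.
Proof. by move=> Lf f1; apply: ereal_sup_ubound; exists f. Qed.

Theorem mainTheorem16 (R : realType) (d : measure_display) (T : measurableType d)
  (mu : {measure set T -> \bar R}) (Phi : R -> R) (k : R)
  (I : set nat) (A : nat -> set T) (U : (T -> R) -> R) :
  sigma_finite setT mu ->
  NStar_function Phi ->
  2 <= k -> (forall x : R, 0 < x -> Phi (k * x) = 2 * Phi x) ->
  atom_family mu I A ->
  (* U is a functional on L_Phi(X): it only depends on the a.e.-class of f *)
  (forall f g, LPhi mu Phi f -> LPhi mu Phi g ->
     {ae mu, forall x, f x = g x} -> U f = U g) ->
  (linear_on_LPhi mu Phi U /\ continuous_on_LPhi mu Phi U) <->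
  ((Lambda mu = set0 /\ forall f, LPhi mu Phi f -> U f = 0)
   \/
   (Lambda mu != set0 /\
    exists u : nat -> R,
      (forall f, LPhi mu Phi f ->
         (fun n => \sum_(0 <= i < n | i \in I) u i * ae_const_val mu (A i) f) @ \oo
           --> U f) /\
      op_norm mu Phi U =
        ereal_sup [set (`|u i| * Phi_inv Phi (1 / fine (mu (A i))))%:E | i in I] /\
      (ereal_sup [set (`|u i| * Phi_inv Phi (1 / fine (mu (A i))))%:E | i in I]
         < +oo)%E)).
Proof.
move=> sfmu NPhi k2 Phik Afam Uae.
have atomI : Lambda mu != set0 -> I !=set0.
  move=> /set0P[B Bat]; have [_ _ /(_ _ Bat)[i [[Ii _] _]]] := Afam.
  by exists i.
split=> [[Ulin Ucont]|[[_ U0]|[L0 [u [Ucvg [normE normfin]]]]]].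
- have [C UC] := continuous_LPhi_bounded NPhi k2 Phik Ulin Ucont.
  have [L0|L0] := eqVneq (Lambda mu) set0.
    (* Without atoms, the vanishing result applies with the whole space as the atomless set. *)
    left; split => // f Lf.
    apply: (bounded_LPhi_atomless NPhi k2 Phik Ulin UC measurableT) => //.
      by move=> E _ _ Eat; have : Lambda mu E by []; rewrite L0.
    by move=> x /(_ Logic.I).
  (* The coefficients are the values of [U] on the indicators of the atoms. *)
  right; split => //; exists (fun i => U (restrict0 (A i) (fun=> 1))).
  have Ucvg f (Lf : LPhi mu Phi f) :=
    family_functional_cvg sfmu NPhi k2 Phik Afam Uae Ulin UC Lf.
  have ub := op_norm_le_sup sfmu NPhi k2 Phik Afam (atomI L0) Ucvg.
  have lb := op_norm_ge_sup sfmu NPhi k2 Phik Afam Ulin.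
  split; first exact: Ucvg.
  split; first by apply/eqP; rewrite eq_le ub.
  apply: (le_lt_trans lb); apply: (@le_lt_trans _ _ C%:E); last exact: ltry.
  apply: ge_ereal_sup => _ [f [Lf f1] <-]; rewrite lee_fin.
  by apply: UC => //; exact: (modular_le1 NPhi k2 Phik).
- split=> [c f g Lf Lg|f Lf e e0].
    by rewrite !U0//; [rewrite mulr0 addr0|exact: (LPhi_lin NPhi k2 Phik)].
  by exists 1 => // g Lg _; rewrite !U0// subrr normr0.
(* Linearity follows from uniqueness of limits, since the partial sums are linear in [f]; continuity
   then follows from the finite norm. *)
- have Ulin : linear_on_LPhi mu Phi U.
    move=> c f g Lf Lg; have Lh := LPhi_lin NPhi k2 Phik c Lf Lg.
    have [mf _] := Lf; have [mg _] := Lg.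
    have h : (fun n => c * (\sum_(0 <= i < n | i \in I) u i * ae_const_val mu (A i) f) +
        \sum_(0 <= i < n | i \in I) u i * ae_const_val mu (A i) g) @ \oo -->
        c * U f + U g.
      exact: cvgD (cvgM (cvg_cst c) (Ucvg _ Lf)) (Ucvg _ Lg).
    rewrite -(cvg_lim (@Rhausdorff R) (Ucvg _ Lh)) -(cvg_lim (@Rhausdorff R) h).
    congr (lim (_ @ \oo)); apply/funext => n /=.
    rewrite mulr_sumr -big_split/=; apply: eq_bigr => i /set_mem Ii.
    by rewrite (family_ae_const_lin sfmu Afam)// mulrDr mulrCA.
  split => //; move: normfin; rewrite -normE => normfin.
  apply: (bounded_LPhi_continuous (M := fine (op_norm mu Phi U)) NPhi k2 Phik Ulin).
  (* Passing to [fine] is harmless: the norm is below [+oo] and dominates a real number, hence is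
     finite. *)
  move=> f Lf f1; have := op_norm_le U Lf f1.
  by move: normfin; case: (op_norm mu Phi U).
Qed.
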